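(* Fix integers $\Lambda\ge1$, $\lambda\in\{1,\dots,\Lambda\}$, $K\ge1$ and $N\ge K$, and consider the ensemble $\mathcal B_\lambda$ of all connectivities in which each of the $K$ users is connected to exactly $\lambda$ of the $\Lambda$ caches, all connectivities being equiprobable. Under a fixed uncoded cache placement (common to all connectivities), the optimal average worst-case load satisfies $R^\star_{\text{avg},\mathcal B_\lambda}(M)\ge R_{\text{avg},\mathcal B_\lambda,\text{LB}}(M)$ for all $M\in[0, N(\Lambda-\lambda+1)/\Lambda]$, where $R_{\text{avg},\mathcal B_\lambda,\text{LB}}$ is the piecewise linear curve with corner points \[ \left(t\frac{N}{\Lambda},\ \frac{K\binom{\Lambda}{t+\lambda}}{\binom{\Lambda}{\lambda}\binom{\Lambda}{t}}+A_t\right),\qquad t\in\{0,1,\dots,\Lambda-\lambda+1\}, \] with \[ A_t=\frac{K}{|\mathcal B_\lambda|}\binom{\Lambda-t}{\lambda}\left(1-\frac{1}{\binom{t+\lambda}{\lambda}}\right),\qquad |\mathcal B_\lambda|=\binom{K+\binom{\Lambda}{\lambda}-1}{K}. \]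
   Context: Multi-access coded caching model: a server holds $N$ files $W_1,\dots,W_N$ of $B$ bits each; $\Lambda$ caches, each storing $MB$ bits; $K$ users, $N\ge K$. Each user $u$ is connected to a subset $\mathcal U_u\subseteq[\Lambda]$ of caches and can read their full contents. A connectivity is identified, up to permutation of users, with the vector $(K_{\mathcal U}:\mathcal U\subseteq[\Lambda])$ of non-negative integers summing to $K$, where $K_{\mathcal U}$ is the number of users whose set of connected caches is exactly $\mathcal U$. $\mathcal B_\lambda$ is the set of all such vectors supported on subsets of size exactly $\lambda$ (so $|\mathcal B_\lambda|=\binom{K+\binom{\Lambda}{\lambda}-1}{K}$). Uncoded placement: each file $W_n$ is partitioned into disjoint subfiles $W_{n,\mathcal T}$, $\mathcal T\subseteq[\Lambda]$, and cache $\ell$ stores exactly the $W_{n,\mathcal T}$ with $\ell\in\mathcal T$, at most $MB$ bits per cache. Delivery: each user requests a file index; the server broadcasts an error-free message $X$ depending on the library and demands; each user must decode its requested file from $X$ and its connected caches. For a placement $P$ and a connectivity $b$, $R_b(P)$ is the minimum over delivery schemes (designed with knowledge of $b$) of the worst-case (over demand vectors) value of $|X|/B$. The optimal average worst-case load over the ensemble is $R^\star_{\text{avg},\mathcal B_\lambda}(M)=\inf_P \frac{1}{|\mathcal B_\lambda|}\sum_{b\in\mathcal B_\lambda}R_b(P)$, the infimum over uncoded placements $P$ of cache size $M$ (the placement is fixed, i.e. chosen without knowledge of the connectivity). A piecewise linear curve with given corner points is the linear interpolation between consecutive points. Convention: $\binom{n}{k}=0$ if $n<0$, $k<0$ or $n<k$.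 *)

(* Defs.v *)
From HB Require Import structures.
From mathcomp Require Import all_boot all_order all_algebra.
Set Implicit Arguments. Unset Strict Implicit. Unset Printing Implicit Defensive.
Import Order.TTheory GRing.Theory Num.Theory.
Local Open Scope ring_scope.

(* A library: N files of B bits each; W n j = bit j of file n. *)
Definition library (N B : nat) := 'I_N -> 'I_B -> bool.

(* Uncoded placement: bit j of file n belongs to the subfile W_{n,T}
   with T = P n j; cache l stores exactly the bits of W_{n,T} with l \in T. *)
Definition placement (Lam N B : nat) := 'I_N -> 'I_B -> {set 'I_Lam}.

Definition cache_ok (R : realFieldType) (Lam N B : nat) (M : R)
  (P : placement Lam N B) : Prop :=
  forall l : 'I_Lam,
    ((\sum_(n < N) #|[set j : 'I_B | l \in P n j]|)%:R <= M * B%:R).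

Definition cache_view (Lam N B : nat) (P : placement Lam N B)
  (U : {set 'I_Lam}) (W : library N B) : 'I_Lam -> 'I_N -> 'I_B -> option bool :=
  fun l n j => if (l \in U) && (l \in P n j) then Some (W n j) else None.

Definition demand (K N : nat) := {ffun 'I_K -> 'I_N}.

Definition delivers (Lam K N B : nat) (P : placement Lam N B)
  (conn : 'I_K -> {set 'I_Lam}) (L : demand K N -> nat) : Prop :=
  forall d : demand K N,
    exists (enc : library N B -> {ffun 'I_(L d) -> bool})
           (dec : 'I_K -> {ffun 'I_(L d) -> bool} ->
                  ('I_Lam -> 'I_N -> 'I_B -> option bool) -> 'I_B -> bool),
      forall (W : library N B) (k : 'I_K) (j : 'I_B),
        dec k (enc W) (cache_view P (conn k) W) j = W (d k) j.

Definition wc_load (R : realFieldType) (K N B : nat) (L : demand K N -> nat) : R :=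
  (\max_(d : demand K N) L d)%:R / B%:R.

(* Connectivity vectors (K_U)_U; each entry is <= K, hence in 'I_K.+1. *)
Definition connvec (Lam K : nat) := {ffun {set 'I_Lam} -> 'I_K.+1}.

Definition Bens (Lam K lam : nat) : {set connvec Lam K} :=
  [set b : connvec Lam K | (\sum_(S : {set 'I_Lam}) (b S : nat) == K)%N
      && [forall S : {set 'I_Lam}, (0 < b S)%N ==> (#|S| == lam)%N]].

Definition realizes (Lam K : nat) (b : connvec Lam K) (conn : 'I_K -> {set 'I_Lam}) :=
  forall S : {set 'I_Lam}, #|[set k : 'I_K | conn k == S]| = b S.

(* r is an achievable average worst-case load for cache size M: some file
   size B, some (connectivity-independent) uncoded placement of cache size M,
   and for each connectivity b in B_lambda a delivery scheme designed for b,
   with average of the worst-case loads equal to r.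
   R*_avg(M) is the infimum of these r. *)
Definition achievable_avg (R : realFieldType) (Lam lam K N : nat) (M r : R) : Prop :=
  exists B : nat, (0 < B)%N /\
  exists P : placement Lam N B, cache_ok M P /\
  exists (conn : connvec Lam K -> 'I_K -> {set 'I_Lam})
         (L : connvec Lam K -> demand K N -> nat),
    (forall b, b \in Bens Lam K lam ->
        realizes b (conn b) /\ delivers P (conn b) (L b)) /\
    r = (#|Bens Lam K lam|%:R)^-1 * \sum_(b in Bens Lam K lam) wc_load R B (L b).

Definition corner_x (R : realFieldType) (Lam N t : nat) : R :=
  t%:R * N%:R / Lam%:R.

Definition Bsize (Lam lam K : nat) : nat := 'C(K + 'C(Lam, lam) - 1, K).

Definition A_t (R : realFieldType) (Lam lam K t : nat) : R :=
  K%:R / (Bsize Lam lam K)%:R * ('C(Lam - t, lam))%:R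
    * (1 - (('C(t + lam, lam))%:R)^-1).

Definition corner_y (R : realFieldType) (Lam lam K t : nat) : R :=
  K%:R * ('C(Lam, t + lam))%:R / (('C(Lam, lam))%:R * ('C(Lam, t))%:R)
  + A_t R Lam lam K t.

(* Main.v *)
(* Fix a connectivity and an ordering of the users requesting distinct files.
Zeroing all bits except those of each user's file that are stored in no cache
of this user or of an earlier one, the message determines the rest by decoding
user after user, so its length is at least the number of these bits. Cyclic
shifts of the demand make this bound symmetric in the files.

Given a permutation s of the caches, order the users by the s-last of their
caches. Averaging over s, a bit stored exactly in the t caches of T counts for
a user with cache set S, |S| = lam, only if S is disjoint from T, and then with
probability 1 / C(t + lam, lam) that S precedes T. For the C(Lam, lam)
connectivities in which all users see the same caches, no averaging is needed
and the weight is 1. Summing over the ensemble, which is symmetric in the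
cache sets, each bit contributes exactly corner_y t. Finally corner_y is convex
and nonincreasing in t, so the interpolating line of a segment lies below it at
all integers, and the memory constraint bounds the mean of t by Lam * M / N. *)

Require Import Defs.
From Stdlib Require Import FunctionalExtensionality.
From HB Require Import structures.
From mathcomp Require Import all_boot all_order all_algebra all_fingroup.
From mathcomp Require Import ring lra zify.
Import Order.TTheory GRing.Theory Num.Theory.
Local Open Scope ring_scope.
Set Implicit Arguments.
Unset Strict Implicit.
Unset Printing Implicit Defensive.

(** * Converse bound for one connectivity and one ordering of the users *)

(** [rk] is the decoding order. Ties are allowed, each tied user then counting the caches of the
    others, so that [rk] may later depend on the cache set alone. *)
Lemma delivers_lower_bound (Lam K N B : nat) (P : placement Lam N B)
    (conn V : 'I_K -> {set 'I_Lam}) (rk : 'I_K -> nat)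
    (L : demand K N -> nat) (d : demand K N) :
  (forall k m, (rk k <= rk m)%N -> conn k \subset V m) ->
  injective d -> delivers P conn L ->
  (\sum_k #|[set j | [disjoint P (d k) j & V k]]| <= L d)%N.
Proof.
move=> connV dinj /(_ d) [enc [dec decP]].
pose A := [set kj : 'I_K * 'I_B | [disjoint P (d kj.1) kj.2 & V kj.1]].
have -> : (\sum_k #|[set j | [disjoint P (d k) j & V k]]| = #|A|)%N.
  transitivity (\sum_k \sum_(j | [disjoint P (d k) j & V k]) 1)%N.
    by apply: eq_bigr => k _; rewrite sum1dep_card.
  by rewrite pair_big_dep /= sum1dep_card.
pose lib (X : {set 'I_K * 'I_B}) : library N B :=
  fun n j => [exists k, (d k == n) && ((k, j) \in X)].
have libE X k j : lib X (d k) j = ((k, j) \in X).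
  apply/existsP/idP => [[m /andP[/eqP/dinj ->]]//|kjX].
  by exists k; rewrite eqxx.
(* Injectivity embeds the [2 ^ #|A|] libraries supported on [A] into the [2 ^ L d] messages. *)
suff enc_inj : {in powerset A &, injective (fun X => enc (lib X))}.
  rewrite -(leq_exp2l (m := 2)) // -card_powerset -(card_in_imset enc_inj).
  by rewrite (leq_trans (max_card _)) // card_ffun card_bool card_ord.
move=> X Y; rewrite !powersetE => /subsetP XA /subsetP YA eqXY.
suff agree r k j : (rk k < r)%N -> ((k, j) \in X) = ((k, j) \in Y).
  by apply/setP => -[k j]; apply: (agree (rk k).+1).
elim: r k j => // r IHr k j; rewrite ltnS => rk_r.
rewrite -!libE -!(decP _ k j) eqXY; congr (dec _ _ _ _).
apply: functional_extensionality => l; apply: functional_extensionality => n.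
apply: functional_extensionality => i; rewrite /cache_view.
case: ifP => // /andP[lU lP]; congr Some; rewrite /lib.
apply: eq_existsb => m; case: eqP => //= dm.
(* A cached bit of the file of [m] is already recovered if [m] ranks below [r]. Otherwise the cache
   holding it lies in [V m], so the bit is outside [A] and zero in both libraries. *)
have [/IHr //|rk_le] := ltnP (rk m) r.
have VP : ~~ [disjoint P (d m) i & V m].
  apply/pred0Pn; exists l; rewrite /= dm lP.
  by apply: (subsetP (connV k m (leq_trans rk_r rk_le))).
by apply/idP/idP => [/XA|/YA]; rewrite inE (negbTE VP).
Qed.

Lemma wc_lower_bound (Lam K N B : nat) (P : placement Lam N B)
    (conn V : 'I_K -> {set 'I_Lam}) (rk : 'I_K -> nat)
    (L : demand K N -> nat) :
  (K <= N)%N -> (0 < N)%N ->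
  (forall k m, (rk k <= rk m)%N -> conn k \subset V m) ->
  delivers P conn L ->
  (\sum_k \sum_n #|[set j | [disjoint P n j & V k]]| <= N * \max_d L d)%N.
Proof.
case: N P L => // N P L KN _ connV delL.
(* Addition is modulo the number of files: over all shifts each user requests every file exactly
   once. *)
pose sh (s : 'I_N.+1) : demand K N.+1 := [ffun k => widen_ord KN k + s].
have sh_inj s : injective (sh s).
  by move=> k m; rewrite !ffunE => /addIr /(congr1 val) /= /val_inj.
apply: (@leq_trans (\sum_s L (sh s))); last first.
  rewrite -[X in (_ <= X * _)%N]card_ord -sum_nat_const.
  by apply: leq_sum => s _; apply: leq_bigmax.
apply: (@leq_trans
  (\sum_s \sum_k #|[set j | [disjoint P (sh s k) j & V k]]|)).
  rewrite [leqRHS]exchange_big; apply: leq_sum => k _ /=.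
  rewrite (reindex_inj (addrI (widen_ord KN k))) /=.
  by apply: leq_sum => s _; rewrite ffunE.
by apply: leq_sum => s _; apply: delivers_lower_bound connV (@sh_inj s) delL.
Qed.

(** * Random orders of the caches *)

Lemma exists_perm_seq (T : finType) (s1 s2 : seq T) :
  uniq s1 -> uniq s2 -> size s1 = size s2 ->
  exists p : {perm T}, map p s1 = s2.
Proof.
case: s1 => [|x0 s1]; first by case: s2 => // _ _ _; exists 1%g.
move: (x0 :: s1) => {}s1 u1 u2 eqs.
pose c (s : seq T) := s ++ enum [predC s].
have uc s : uniq s -> uniq (c s).
  move=> us; rewrite cat_uniq us enum_uniq andbT /=.
  by apply/hasPn => x; rewrite mem_enum.
have memc s x : x \in c s by rewrite mem_cat mem_enum inE; case: (x \in s).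
have sz s : uniq s -> size (c s) = #|T|.
  move=> us; rewrite -(card_uniqP (uc _ us)).
  by apply: eq_card => x; rewrite memc.
(* Both sequences are completed to enumerations of [T] and matched position by position; the default
   [x] is never reached. *)
pose f x := nth x (c s2) (index x (c s1)).
have ix x : (index x (c s1) < size (c s2))%N by rewrite sz // -(sz s1) // index_mem.
have f_inj : injective f.
  move=> x y; rewrite /f (set_nth_default x) // => /eqP.
  rewrite nth_uniq ?uc // => /eqP eq_ix.
  by rewrite -(nth_index x (memc s1 x)) eq_ix nth_index.
exists (perm f_inj).
apply: (@eq_from_nth _ x0) => [|i]; rewrite size_map // => i_lt.
rewrite (nth_map x0) // permE /f index_cat mem_nth // index_uniq //.
by rewrite nth_cat -eqs i_lt (set_nth_default x0) -?eqs.
Qed.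

Definition precedes (n : nat) (s : {perm 'I_n}) (U T : {set 'I_n}) :=
  [forall x in U, forall y in T, (s x < s y)%N].

Lemma precedesP (n : nat) (s : {perm 'I_n}) (U T : {set 'I_n}) :
  reflect {in U & T, forall x y, (s x < s y)%N} (precedes s U T).
Proof.
apply: (iffP forall_inP) => [H x y xU yT|H x xU].
  by have /forall_inP := H _ xU; apply.
by apply/forall_inP => y; apply: H.
Qed.

Lemma exists_initial_segment (n u : nat) (s : {perm 'I_n}) (S : {set 'I_n}) :
  (u <= #|S|)%N ->
  exists U : {set 'I_n}, [/\ U \subset S, #|U| = u & precedes s U (S :\: U)].
Proof.
move=> uS; pose q := sort (relpre s leq) (enum S).
have q_uniq : uniq q by rewrite sort_uniq enum_uniq.
have memq x : (x \in q) = (x \in S) by rewrite mem_sort mem_enum.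
have : pairwise (relpre s leq) q.
  rewrite -sorted_pairwise ?sort_sorted // => [x y|y x z]; first exact: leq_total.
  exact: leq_trans.
rewrite -{1}(cat_take_drop u q) pairwise_cat => /and3P[/allrelP le_td _ _].
exists [set x in take u q]; split.
- by apply/subsetP => x; rewrite inE => /mem_take; rewrite memq.
- rewrite cardsE (card_uniqP _) ?take_uniq // size_takel //.
  by rewrite size_sort -cardE.
- apply/precedesP => x y; rewrite !inE => xq /andP[yq yS].
  have yd : y \in drop u q.
    by move: yS; rewrite -memq -{1}(cat_take_drop u q) mem_cat (negbTE yq).
  have /= le_xy := le_td _ _ xq yd.
  rewrite ltn_neqAle le_xy andbT; apply: contraNneq yq => /val_inj/perm_inj <- //.
Qed.

(** Composition with a permutation carrying [U] to [U'] and [T] to [T'] injects the orders on the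
    left into those on the right. *)
Lemma card_precedes_le (n : nat) (U U' T T' : {set 'I_n}) :
  [disjoint U & T] -> [disjoint U' & T'] -> #|U| = #|U'| -> #|T| = #|T'| ->
  (#|[set s | precedes s U' T']| <= #|[set s | precedes s U T]|)%N.
Proof.
have eU (A B : {set 'I_n}) : [disjoint A & B] -> uniq (enum A ++ enum B).
  move=> dAB; rewrite cat_uniq !enum_uniq andbT /=.
  apply/hasPn => x; rewrite !mem_enum => xB.
  by apply: contraL dAB => xA; apply/pred0Pn; exists x; rewrite /= xA.
move=> dUT dUT' eqU eqT.
have [|p] := exists_perm_seq (eU _ _ dUT) (eU _ _ dUT').
  by rewrite !size_cat -!cardE eqU eqT.
move/eqP; rewrite map_cat eqseq_cat ?size_map -?cardE //.
case/andP=> /eqP pU /eqP pT.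
rewrite -(card_imset _ (@mulgI _ p)); apply: subset_leq_card.
apply/subsetP => _ /imsetP[s sP ->]; move: sP; rewrite !inE => /precedesP sP.
apply/precedesP => x y xU yT; rewrite !permM; apply: sP.
  by rewrite -mem_enum -pU map_f ?mem_enum.
by rewrite -mem_enum -pT map_f ?mem_enum.
Qed.

(* Every s puts some |U|-subset of U :|: T first, and by symmetry each of these
   subsets comes first equally often. *)
Lemma card_precedes (n : nat) (U T : {set 'I_n}) :
  [disjoint U & T] ->
  (n`! <= #|[set s | precedes s U T]| * 'C(#|T| + #|U|, #|U|))%N.
Proof.
move=> dUT; pose S := U :|: T.
have cS : #|S| = (#|T| + #|U|)%N.
  by rewrite addnC -(cardsUI U T) (disjoint_setI0 dUT) cards0 addn0.
pose E := [set X : {set 'I_n} | X \subset S & #|X| == #|U|].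
rewrite -cS mulnC -cards_draws -/E -sum_nat_const.
have <- : #|[set: {perm 'I_n}]| = n`! by rewrite cardsT card_Sn.
apply: (@leq_trans #|\bigcup_(X in E) [set s | precedes s X (S :\: X)]|).
  apply: subset_leq_card; apply/subsetP => s _.
  have [|X [XS cX sX]] := @exists_initial_segment n #|U| s S.
    by rewrite cS leq_addl.
  by apply/bigcupP; exists X; rewrite !inE ?XS ?cX ?eqxx.
apply: (@leq_trans (\sum_(X in E) #|[set s | precedes s X (S :\: X)]|)).
  elim/big_rec2: _ => [|X m D _ le_Dm]; first by rewrite cards0.
  by rewrite (leq_trans (leq_card_setU _ _)) // leq_add2l.
apply: leq_sum => X; rewrite inE => /andP[XS /eqP cX].
apply: card_precedes_le => //.
  by rewrite -setI_eq0; apply/eqP/setP => x; rewrite !inE; case: (x \in X).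
by rewrite cardsD (setIidPr XS) cX cS addnK.
Qed.

(** * Counting in the ensemble *)

(** Stars and bars: such functions are the tuples of their values along [enum D]. *)
Lemma card_bounded_ffun (I : finType) (D : {set I}) (K : nat) :
  (0 < #|D|)%N ->
  #|[set f : {ffun I -> 'I_K.+1} | (\sum_x (f x : nat) == K)%N
      && [forall x, (0 < f x)%N ==> (x \in D)]]| = 'C(K + #|D| - 1, K).
Proof.
case cD: #|D| => [//|m] _.
have -> : 'C(K + m.+1 - 1, K) = 'C(m + K, m).
  by rewrite addnS subn1 /= -bin_sub ?leq_addr // addKn addnC.
rewrite -card_ord_partitions.
have szD : size (enum D) = m.+1 by rewrite -cardE.
(* Outside [D] the index is the length of the tuple, so the default [ord0] supplies the zero
   value. *)
pose h (t : m.+1.-tuple 'I_K.+1) : {ffun I -> 'I_K.+1} :=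
  [ffun x => nth ord0 t (index x (enum D))].
have [x0 x0D] : exists x, x \in D by apply/card_gt0P; rewrite cD.
have hE (t : m.+1.-tuple 'I_K.+1) i :
    (i < m.+1)%N -> h t (nth x0 (enum D) i) = nth ord0 t i.
  by move=> im; rewrite ffunE index_uniq ?enum_uniq ?szD.
have h_out t x : x \notin D -> h t x = ord0.
  move=> xD; rewrite ffunE nth_default // size_tuple -szD leqNgt index_mem.
  by rewrite mem_enum.
have h_inj : injective h.
  move=> t1 t2 eq_h; apply: val_inj; apply: (@eq_from_nth _ ord0) => [|i].
    by rewrite !size_tuple.
  by rewrite size_tuple => im; rewrite -!hE // eq_h.
have sum_h t : (\sum_x (h t x : nat) = \sum_(i <- t) i)%N.
  rewrite (bigID [in D]) /= [X in (_ + X)%N]big1 => [|x /h_out -> //].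
  rewrite addn0 -big_enum (big_nth x0) szD (big_nth ord0) size_tuple.
  by rewrite !big_nat; apply: eq_bigr => i /= im; rewrite hE.
rewrite -(card_imset _ h_inj); apply: eq_card => f; rewrite inE.
apply/andP/imsetP => [[sumf /forallP suppf]|[t]]; last first.
  rewrite inE -sum_h => sumt ->; split=> //; apply/forallP => x.
  by apply/implyP; apply: contraTT => /h_out ->.
suff [t eq_f] : exists t, h t = f.
  by exists t; rewrite // inE -sum_h eq_f.
exists [tuple f (nth x0 (enum D) i) | i < m.+1]; apply/ffunP => x.
have [xD|xD] := boolP (x \in D); last first.
  rewrite h_out //; apply/val_inj/esym/eqP => /=.
  by have := suppf x; rewrite (negbTE xD) implybF -eqn0Ngt.
have ix : (index x (enum D) < m.+1)%N by rewrite -szD index_mem mem_enum.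
rewrite -[x in LHS](nth_index x0 (s := enum D)) ?mem_enum // hE //.
by rewrite -[index _ _]/(val (Ordinal ix)) -tnth_nth tnth_mktuple /= nth_index ?mem_enum.
Qed.

Lemma card_Bens (Lam K lam : nat) :
  (lam <= Lam)%N -> #|Bens Lam K lam| = Bsize Lam lam K.
Proof.
move=> lamLam; pose D := [set S : {set 'I_Lam} | #|S| == lam].
have cD : #|D| = 'C(Lam, lam) by rewrite card_draws card_ord.
rewrite /Bsize -cD -card_bounded_ffun ?cD ?bin_gt0 //.
by apply: eq_card => b; rewrite !inE; congr (_ && _); apply: eq_forallb => S; rewrite inE.
Qed.

(** The symmetry swaps two cache sets, not caches: the ensemble is invariant under any permutation
    of the sets of size [lam]. *)
Lemma sum_Bens_transfer (Lam K lam : nat) (S S' : {set 'I_Lam}) :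
  #|S| = lam -> #|S'| = lam ->
  (\sum_(b in Bens Lam K lam) b S = \sum_(b in Bens Lam K lam) b S')%N.
Proof.
move=> cS cS'; pose p := tperm S S'.
have cp X : (#|p X| == lam)%N = (#|X| == lam)%N.
  by rewrite /p; case: tpermP => [->|->|//]; rewrite cS cS'.
pose h (b : connvec Lam K) : connvec Lam K := [ffun X => b (p X)].
have hK : involutive h by move=> b; apply/ffunP => X; rewrite !ffunE tpermK.
rewrite (reindex_inj (inv_inj hK)) /=; apply: eq_big => [b|b _]; last first.
  by rewrite ffunE tpermL.
rewrite !inE; congr (_ && _).
  rewrite [in RHS](reindex_inj (@perm_inj _ p)) /=.
  by congr (_ == _); apply: eq_bigr => X _; rewrite ffunE.
apply/forallP/forallP => H X; have := H (p X); rewrite ffunE cp //.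
by rewrite tpermK.
Qed.

Lemma sum_Bens (Lam K lam : nat) (S : {set 'I_Lam}) :
  #|S| = lam ->
  ('C(Lam, lam) * \sum_(b in Bens Lam K lam) b S = #|Bens Lam K lam| * K)%N.
Proof.
move=> cS; rewrite -sum_nat_const.
have -> : 'C(Lam, lam) = #|[set X : {set 'I_Lam} | #|X| == lam]|.
  by rewrite card_draws card_ord.
transitivity (\sum_(b in Bens Lam K lam) \sum_X (b X : nat))%N; last first.
  by apply: eq_bigr => b; rewrite inE => /andP[/eqP].
rewrite exchange_big (bigID (fun X : {set 'I_Lam} => #|X| == lam)) /=.
rewrite [X in _ = (_ + X)%N]big1 ?addn0 => [|X cX]; last first.
  rewrite big1 // => b; rewrite inE => /andP[_ /forallP/(_ X)].
  by rewrite (negbTE cX) implybF -eqn0Ngt => /eqP.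
rewrite -sum_nat_const; apply: eq_big => [X|X]; rewrite inE // => /eqP cX.
exact: sum_Bens_transfer.
Qed.

(** The connectivity placing all users on [S] already contributes [K]. This is the source of the
    term [A_t]. *)
Lemma sum_constant_Bens (Lam K lam : nat) (S : {set 'I_Lam}) :
  (0 < K)%N -> #|S| = lam ->
  (K <= \sum_(b in Bens Lam K lam | [exists X, b X == K :> nat]) b S)%N.
Proof.
move=> K0 cS; pose b : connvec Lam K := [ffun X => if X == S then ord_max else ord0].
have bS : b S = K :> nat by rewrite ffunE eqxx.
rewrite (bigD1 b) /=; first by rewrite bS leq_addr.
apply/andP; split; last by apply/existsP; exists S; rewrite bS.
rewrite inE (bigD1 S) //= bS big1 ?addn0 ?eqxx => [|X /negbTE XS]; last first.
  by rewrite ffunE XS.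
by apply/forallP => X; rewrite ffunE; case: eqP => [->|] //=; rewrite cS eqxx implybT.
Qed.

(** * Convexity of the corner points *)

(** Nonnegativity is included to make the class closed under products. *)
Definition convex_decreasing (R : realFieldType) (f : nat -> R) :=
  forall s, [/\ 0 <= f s, f s.+1 <= f s & f s.+1 - f s.+2 <= f s - f s.+1].

Lemma convex_decreasingM (R : realFieldType) (f g : nat -> R) :
  convex_decreasing f -> convex_decreasing g ->
  convex_decreasing (fun s => f s * g s).
Proof.
move=> cf cg s; have [f0 df ddf] := cf s; have [g0 dg ddg] := cg s.
have [f1 df1 _] := cf s.+1; have [g1 dg1 _] := cg s.+1.
split; [exact: mulr_ge0|exact: ler_pM|].
rewrite -subr_ge0; set A := f s; set B := f s.+1; set C := f s.+2.
set A' := g s; set B' := g s.+1; set C' := g s.+2.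
(* Discrete Leibniz rule for the second difference; every summand is a product of nonnegative
   factors. *)
have -> : A * A' - B * B' - (B * B' - C * C') =
  B * ((A' - B') - (B' - C')) + B' * ((A - B) - (B - C))
  + (A - B) * (A' - B') + (B - C) * (B' - C') by ring.
by rewrite !addr_ge0 // mulr_ge0 // subr_ge0.
Qed.

Lemma convex_decreasing_affine (R : realFieldType) (a b : R) (f : nat -> R) :
  0 <= a -> 0 <= b -> convex_decreasing f ->
  convex_decreasing (fun s => a + b * f s).
Proof.
move=> a0 b0 cf s; have [f0 df ddf] := cf s.
split; first by rewrite addr_ge0 // mulr_ge0.
  by rewrite lerD2l ler_wpM2l.
have := ler_wpM2l b0 ddf; lra.
Qed.

(** Increments of [f] are nondecreasing, so walking right or left from [t] never falls below the
    line through the points at [t] and [t.+1]. *)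
Lemma convex_decreasing_supporting_line (R : realFieldType) (f : nat -> R) t s :
  convex_decreasing f -> f t + (f t.+1 - f t) * (s%:R - t%:R) <= f s.
Proof.
move=> cf; have mono n m : (n <= m)%N -> f n.+1 - f n <= f m.+1 - f m.
  move=> /subnK <-; elim: (m - n)%N => // k IH; rewrite addSn.
  by apply: le_trans IH _; have [_ _] := cf (k + n)%N; lra.
have above k : f t + (f t.+1 - f t) * k%:R <= f (k + t)%N.
  elim: k => [|k IH]; first by rewrite mulr0 addr0.
  have := mono t (k + t)%N (leq_addl _ _).
  by move: IH; rewrite addSn -natr1; lra.
have below k n : f (k + n)%N - (f (k + n).+1 - f (k + n)%N) * k%:R <= f n.
  elim: k => [|k IH]; first by rewrite mulr0 subr0.
  have d := mono (k + n)%N (k + n).+1 (leqnSn _).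
  have := ler_wpM2r (ler0n R k) d.
  by move: IH; rewrite addSn -natr1; lra.
have [ts|/ltnW st] := leqP t s.
  by have := above (s - t)%N; rewrite subnK // natrB.
by have := below (t - s)%N s; rewrite subnK // natrB //; lra.
Qed.

Lemma convex_decreasing_bin_sub (R : realFieldType) (n l : nat) :
  (0 < l)%N -> convex_decreasing (fun s => 'C(n - s, l)%:R : R).
Proof.
case: l => // l _ s; split; first exact: ler0n.
  by rewrite ler_nat leq_bin2l // leq_sub2l.
(* Where the subtraction truncates, the last two values vanish; elsewhere Pascal's rule turns the
   differences into nonincreasing binomials. *)
have [sn|ns] := leqP s.+2 n; last first.
  have -> : (n - s.+1 = 0)%N by lia.
  have -> : (n - s.+2 = 0)%N by lia.
  by rewrite !bin0n /= !subr0.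
have -> : (n - s = (n - s.+2).+2)%N by lia.
have -> : (n - s.+1 = (n - s.+2).+1)%N by lia.
rewrite !binS !natrD.
have : 'C(n - s.+2, l)%:R <= ('C((n - s.+2).+1, l)%:R : R).
  by rewrite ler_nat leq_bin2l.
by case: l => [|l]; rewrite ?bin0 ?binS ?natrD; lra.
Qed.

Lemma convex_decreasing_inv_bin (R : realFieldType) (l : nat) :
  convex_decreasing (fun s => ('C(s + l, l)%:R)^-1 : R).
Proof.
have c0 s : 0 < ('C(s + l, l)%:R : R) by rewrite ltr0n bin_gt0 leq_addl.
(* The decrement is a product of two nonnegative nonincreasing factors, which gives convexity. *)
have ratio s : ('C(s + l, l)%:R)^-1 - ('C(s.+1 + l, l)%:R)^-1
    = ('C(s + l, l)%:R)^-1 * (l%:R / (s.+1 + l)%:R) :> R.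
  have e : (s.+1)%:R * 'C(s.+1 + l, l)%:R = (s.+1%:R + l%:R) * 'C(s + l, l)%:R :> R.
    rewrite -natrD -!natrM; congr (_%:R); have /= -> := mul_bin_down (s.+1 + l) l.
    by rewrite addnK.
  have s0 : s.+1%:R != 0 :> R by rewrite pnatr_eq0.
  have sl0 : s.+1%:R + l%:R != 0 :> R by rewrite -natrD pnatr_eq0.
  have -> : 'C(s.+1 + l, l)%:R = (s.+1%:R + l%:R) * 'C(s + l, l)%:R / s.+1%:R :> R.
    by rewrite -e mulrC mulKf.
  rewrite natrD; move: (s.+1%:R : R) s0 sl0 (c0 s) => m m0 ml0 /lt0r_neq0 b0.
  by field; rewrite m0 ml0 b0.
have dec s : ('C(s.+1 + l, l)%:R)^-1 <= ('C(s + l, l)%:R)^-1 :> R.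
  by rewrite -subr_ge0 ratio mulr_ge0 ?invr_ge0 ?divr_ge0 ?ler0n.
move=> s; split=> //; first by rewrite invr_ge0 ltW.
rewrite !ratio ler_pM ?dec ?invr_ge0 ?divr_ge0 ?ler0n //.
by rewrite ler_wpM2l // lef_pV2 ?posrE ?ltr0n // ler_nat.
Qed.

(* The summand 0 puts the first factor in the form of convex_decreasing_affine. *)
Lemma corner_yE (R : realFieldType) (Lam lam K t : nat) :
  (0 < lam <= Lam)%N -> (t <= Lam)%N ->
  corner_y R Lam lam K t =
  (0 + K%:R / 'C(Lam, lam)%:R * 'C(Lam - t, lam)%:R)
  * ('C(Lam, lam)%:R / (Bsize Lam lam K)%:R
     + (1 - 'C(Lam, lam)%:R / (Bsize Lam lam K)%:R) * ('C(t + lam, lam)%:R)^-1).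
Proof.
move=> /andP[lam0 lamLam] tLam; rewrite /corner_y /A_t.
have Cn0 n m : (m <= n)%N -> 'C(n, m)%:R != 0 :> R.
  by move=> mn; rewrite pnatr_eq0 -lt0n bin_gt0.
have [sLam|sLam] := leqP (t + lam) Lam; last first.
  rewrite (bin_small sLam) (@bin_small (Lam - t) lam); last lia.
  by rewrite !(mulr0, mul0r, addr0).
(* Cleared of the denominator, both sides count pairs of disjoint sets of [t] and [lam] caches. *)
have e : 'C(Lam, t + lam)%:R = 'C(Lam, t)%:R * 'C(Lam - t, lam)%:R / 'C(t + lam, lam)%:R :> R.
  apply/(canRL (mulfK (Cn0 _ _ (leq_addl _ _)))); rewrite -!natrM; congr (_%:R).
  apply/eqP; rewrite -(eqn_pmul2r (fact_gt0 (Lam - t - lam))).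
  rewrite -(eqn_pmul2r (fact_gt0 t)) -(eqn_pmul2r (fact_gt0 lam)).
  have f1 := bin_fact sLam; have f2 := bin_fact tLam.
  have f3 := bin_fact (leq_addl t lam); rewrite addnK in f3.
  have lt : (lam <= Lam - t)%N by lia.
  have f4 := bin_fact lt; rewrite subnDA in f1.
  apply/eqP; nia.
have B0 : (Bsize Lam lam K)%:R != 0 :> R.
  apply: Cn0; have : (0 < 'C(Lam, lam))%N by rewrite bin_gt0.
  by move=> ?; lia.
rewrite e; field.
by rewrite B0 !Cn0 ?leq_addl.
Qed.

(** * Averaging over the ensemble *)

(** Users are grouped by cache set. Only cache sets that occur are constrained, so [V] may be the
    identity when all users see the same caches. *)
Lemma delivers_sum_le (Lam K N B : nat) (P : placement Lam N B)
    (b : connvec Lam K) (conn : 'I_K -> {set 'I_Lam}) (L : demand K N -> nat)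
    (V : {set 'I_Lam} -> {set 'I_Lam}) (rk : {set 'I_Lam} -> nat) :
  (K <= N)%N -> (0 < N)%N -> realizes b conn -> delivers P conn L ->
  (forall S S', (0 < b S)%N -> (0 < b S')%N ->
     (rk S <= rk S')%N -> S \subset V S') ->
  (\sum_S b S * \sum_nj [disjoint P nj.1 nj.2 & V S] <= N * \max_d L d)%N.
Proof.
move=> KN N0 bconn delL subV.
have b_conn k : (0 < b (conn k))%N.
  by rewrite -bconn; apply/card_gt0P; exists k; rewrite inE.
have := @wc_lower_bound _ _ _ _ P conn (V \o conn) (rk \o conn) L KN N0.
move=> /(_ _ delL) H; apply: leq_trans (H _); last by move=> k m; apply: subV.
rewrite (partition_big conn predT) //=; apply: leq_sum => S _.
rewrite -bconn -sum_nat_const; apply: eq_leq.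
apply: eq_big => [k|k]; rewrite inE // => /eqP ->.
rewrite -(pair_bigA _ (fun n j => [disjoint P n j & V S] : nat)) /=.
apply: eq_bigr => n _; rewrite -sum1dep_card [RHS]big_mkcond /=.
by apply: eq_bigr => j _; case: [disjoint _ & _].
Qed.

(** It contains every cache set whose [s]-last cache is no later than that of [S], and is
    independent of the connectivity. *)
Definition prefix_closure (n : nat) (s : {perm 'I_n}) (S : {set 'I_n}) :=
  [set l | (s l <= \max_(u in S) s u)%N].

Lemma precedes_disjoint (n : nat) (s : {perm 'I_n}) (S T : {set 'I_n}) :
  (0 < #|S|)%N -> precedes s S T -> [disjoint T & prefix_closure s S].
Proof.
move=> S0 /precedesP sST; rewrite -setI_eq0; apply/eqP/setP => y.
rewrite !inE; apply/negbTE/negP => /andP[yT].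
have [u uS ->] := eq_bigmax_cond (fun u => s u : nat) S0.
by rewrite leqNgt sST.
Qed.

Lemma delivers_sum_le_avg (R : realFieldType) (Lam lam K N B : nat)
    (P : placement Lam N B) (b : connvec Lam K) (conn : 'I_K -> {set 'I_Lam})
    (L : demand K N -> nat) :
  (0 < lam)%N -> (K <= N)%N -> (0 < N)%N -> b \in Bens Lam K lam ->
  realizes b conn -> delivers P conn L ->
  \sum_S (b S)%:R * \sum_nj [disjoint P nj.1 nj.2 & S]%:R
    * ('C(#|P nj.1 nj.2| + lam, lam)%:R)^-1 <= (N * \max_d L d)%:R :> R.
Proof.
move=> lam0 KN N0 bB bconn delL.
rewrite -(ler_pM2l (_ : 0 < Lam`!%:R)) ?ltr0n ?fact_gt0 //.
apply: (@le_trans _ _ (\sum_(s : {perm 'I_Lam}) \sum_S b S *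
    \sum_nj [disjoint P nj.1 nj.2 & prefix_closure s S])%:R); last first.
  rewrite -natrM ler_nat -card_Sn -sum_nat_const.
  by apply: leq_sum => s _; apply: (delivers_sum_le KN N0 bconn delL
    (rk := fun S => \max_(u in S) s u)%N) => S S' _ _ le_rk;
    apply/subsetP => l lS; rewrite inE; apply: leq_trans le_rk;
    apply: leq_bigmax_cond.
have -> : (\sum_(s : {perm 'I_Lam}) \sum_S b S *
      \sum_nj [disjoint P nj.1 nj.2 & prefix_closure s S] =
    \sum_S b S *
      \sum_nj #|[set s | [disjoint P nj.1 nj.2 & prefix_closure s S]]|)%N.
  rewrite exchange_big; apply: eq_bigr => S _ /=.
  rewrite -big_distrr exchange_big; congr (_ * _)%N; apply: eq_bigr => nj _ /=.
  rewrite -sum1dep_card [RHS]big_mkcond.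
  by apply: eq_bigr => s _; case: [disjoint _ & _].
rewrite natr_sum mulr_sumr; apply: ler_sum => S _.
have [->|bS] := posnP (b S); first by rewrite !(mul0r, mulr0).
have cS : #|S| = lam.
  by move: bB; rewrite inE => /andP[_ /forallP/(_ S)]; rewrite bS => /eqP.
rewrite natrM mulrCA ler_wpM2l // natr_sum mulr_sumr; apply: ler_sum => nj _.
have [disj|_] := boolP [disjoint _ & _]; last by rewrite mul0r mulr0 ler0n.
rewrite mul1r ler_pdivrMr ?ltr0n ?bin_gt0 ?leq_addl // -natrM ler_nat -cS.
(* A bit is counted whenever [S] precedes its caches, hence for at least a fraction
   [1 / 'C(t + lam, lam)] of the orders. *)
rewrite (leq_trans (@card_precedes _ S (P nj.1 nj.2) _)) 1?disjoint_sym //.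
rewrite leq_mul2r; apply/orP; right; apply: subset_leq_card.
by apply/subsetP => s; rewrite !inE; apply: precedes_disjoint; rewrite cS.
Qed.

Lemma constant_connvec_support (Lam K lam : nat) (b : connvec Lam K) S S' :
  (0 < K)%N -> b \in Bens Lam K lam -> b S = K :> nat -> (0 < b S')%N -> S' = S.
Proof.
move=> K0; rewrite inE => /andP[/eqP sumb _] bS bS'; apply: contraTeq bS' => neq.
move: sumb; rewrite (bigD1 S) //= bS (bigD1 S') //= -eqn0Ngt.
by move/eqP; rewrite -[in X in _ == X](addn0 K) eqn_add2l addn_eq0 => /andP[].
Qed.

Lemma Bens_load_lower_bound (R : realFieldType) (Lam lam K N B : nat)
    (P : placement Lam N B) (b : connvec Lam K) (conn : 'I_K -> {set 'I_Lam})
    (L : demand K N -> nat) :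
  (0 < lam)%N -> (0 < K <= N)%N -> b \in Bens Lam K lam ->
  realizes b conn -> delivers P conn L ->
  \sum_S (b S)%:R * \sum_nj [disjoint P nj.1 nj.2 & S]%:R
    * (if [exists X, b X == K :> nat] then 1
       else ('C(#|P nj.1 nj.2| + lam, lam)%:R)^-1)
  <= (N * \max_d L d)%:R :> R.
Proof.
move=> lam0 /andP[K0 KN] bB bconn delL; have N0 := leq_trans K0 KN.
case: existsP => [[X /eqP bX]|_]; last exact: (delivers_sum_le_avg R lam0 KN N0 bB).
have supp := constant_connvec_support K0 bB bX.
apply: (@le_trans _ _
    (\sum_S b S * \sum_nj [disjoint P nj.1 nj.2 & S])%N%:R); last first.
  rewrite ler_nat; apply: (delivers_sum_le KN N0 bconn delL (V := id)
    (rk := fun=> 0%N)) => S S' /supp -> /supp -> //.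
rewrite natr_sum ler_sum // => S _; rewrite natrM natr_sum ler_wpM2l //.
by apply: ler_sum => nj _; rewrite mulr1.
Qed.

Lemma sum_max_load_lower_bound (R : realFieldType) (Lam lam K N B : nat)
    (P : placement Lam N B) (conn : connvec Lam K -> 'I_K -> {set 'I_Lam})
    (L : connvec Lam K -> demand K N -> nat) :
  (0 < lam <= Lam)%N -> (0 < K <= N)%N ->
  (forall b, b \in Bens Lam K lam ->
     realizes b (conn b) /\ delivers P (conn b) (L b)) ->
  \sum_(nj : 'I_N * 'I_B) (Bsize Lam lam K)%:R * corner_y R Lam lam K #|P nj.1 nj.2|
  <= N%:R * \sum_(b in Bens Lam K lam) (\max_d L b d)%:R.
Proof.
move=> lamLam KN delL; have /andP[lam0 lamL] := lamLam; have /andP[K0 _] := KN.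
pose c nj : R := ('C(#|P nj.1 nj.2| + lam, lam)%:R)^-1.
pose const (b : connvec Lam K) := [exists X, b X == K :> nat].
pose C : R := 'C(Lam, lam)%:R; pose Bs : R := (Bsize Lam lam K)%:R.
have C0 : C != 0 by rewrite pnatr_eq0 -lt0n bin_gt0.
have Bs0 : Bs != 0.
  have : (0 < 'C(Lam, lam))%N by rewrite bin_gt0.
  by move=> ?; rewrite pnatr_eq0 -lt0n bin_gt0; lia.
rewrite mulr_sumr.
apply: (@le_trans _ _ (\sum_(b in Bens Lam K lam) \sum_S (b S)%:R *
    \sum_nj [disjoint P nj.1 nj.2 & S]%:R * (if const b then 1 else c nj))).
  have -> : \sum_(b in Bens Lam K lam) \sum_S (b S)%:R *
      \sum_nj [disjoint P nj.1 nj.2 & S]%:R * (if const b then 1 else c nj) =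
    \sum_(nj : 'I_N * 'I_B) \sum_(S : {set 'I_Lam}) [disjoint P nj.1 nj.2 & S]%:R *
      \sum_(b in Bens Lam K lam) (b S)%:R * (if const b then 1 else c nj).
    under eq_bigr => b _ do under eq_bigr do rewrite mulr_sumr.
    under [RHS]eq_bigr do under eq_bigr do rewrite mulr_sumr.
    rewrite exchange_big /= [RHS]exchange_big /=; apply: eq_bigr => S _.
    rewrite exchange_big /=; apply: eq_bigr => nj _; apply: eq_bigr => b _.
    by rewrite mulrCA.
  apply: ler_sum => nj _; set T := P nj.1 nj.2.
  pose D := [set S : {set 'I_Lam} | S \subset ~: T & #|S| == lam].
  (* Each [S] disjoint from [T] receives weight [c nj] from the whole ensemble and the excess
     [1 - c nj] from the constant connectivities. *)
  apply: (@le_trans _ _ (\sum_(S in D) (Bs * K%:R / C * c nj + K%:R * (1 - c nj)))).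
    have cT : #|~: T| = (Lam - #|T|)%N by rewrite cardsCs setCK card_ord.
    rewrite sumr_const cards_draws cT -mulr_natl.
    rewrite corner_yE ?lamLam //; last by rewrite -[leqRHS]card_ord max_card.
    rewrite -/Bs -/C -/(c nj) add0r le_eqVlt; apply/orP; left; apply/eqP.
    by field; rewrite Bs0 C0.
  rewrite big_mkcond /=; apply: ler_sum => S _.
  have [|_] := boolP (S \in D); last first.
    rewrite mulr_ge0 ?sumr_ge0 // => b _; rewrite mulr_ge0 //.
    by case: ifP => // _; rewrite invr_ge0.
  rewrite inE -disjoints_subset disjoint_sym => /andP[-> /eqP cS]; rewrite mul1r.
  have c1 : 0 <= 1 - c nj.
    by rewrite subr_ge0 invf_le1 ?ler1n ?ltr0n bin_gt0 leq_addl.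
  have -> : \sum_(b in Bens Lam K lam) (b S)%:R * (if const b then 1 else c nj) =
      (\sum_(b in Bens Lam K lam) b S)%N%:R * c nj +
      (\sum_(b in Bens Lam K lam | const b) b S)%N%:R * (1 - c nj).
    rewrite !natr_sum big_mkcondr /= !mulr_suml -big_split /=.
    by apply: eq_bigr => b _; case: ifP => _; ring.
  apply: lerD; last by rewrite ler_wpM2r // ler_nat sum_constant_Bens.
  have := congr1 (fun n => n%:R : R) (sum_Bens K cS).
  rewrite card_Bens // !natrM -/Bs -/C => <-.
  by rewrite [X in X / C]mulrC mulfK.
apply: ler_sum => b bB; have [bconn del] := delL b bB.
by rewrite -natrM; apply: Bens_load_lower_bound.
Qed.

(* R*_avg(M) >= R_LB(M) for M in [0, N(Lam-lam+1)/Lam]: stated as: every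
   achievable average load r is >= the linear interpolation of the corner
   points on each segment [x_t, x_{t+1}], t = 0..Lam-lam, containing M. *)
Theorem theorem2 (R : realFieldType) (Lam lam K N : nat) (M : R) :
  (1 <= Lam)%N -> (1 <= lam <= Lam)%N -> (1 <= K)%N -> (K <= N)%N ->
  forall r : R, achievable_avg Lam lam K N M r ->
  forall t : nat, (t < Lam - lam + 1)%N ->
    corner_x R Lam N t <= M <= corner_x R Lam N t.+1 ->
    corner_y R Lam lam K t
      + (corner_y R Lam lam K t.+1 - corner_y R Lam lam K t)
        * (M - corner_x R Lam N t) / (corner_x R Lam N t.+1 - corner_x R Lam N t)
    <= r.
Proof.
move=> Lam0 lamLam K0 KN r [B [B0 [P [cacheP [conn [L [delL ->]]]]]]] t tLam _.
have N0 := leq_trans K0 KN; have /andP[lam0 lamL] := lamLam.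
pose c := 'C(Lam, lam)%:R / (Bsize Lam lam K)%:R : R.
pose y s := (0 + K%:R / 'C(Lam, lam)%:R * 'C(Lam - s, lam)%:R)
  * (c + (1 - c) * ('C(s + lam, lam)%:R)^-1) : R.
have C0 : (0 < 'C(Lam, lam))%N by rewrite bin_gt0.
have Bs0 : (0 < Bsize Lam lam K)%N by rewrite bin_gt0; lia.
(* This makes the coefficient [1 - c] in [y] nonnegative. *)
have CB : ('C(Lam, lam) <= Bsize Lam lam K)%N.
  rewrite /Bsize; case: (K) K0 => // k _; case: 'C(Lam, lam) C0 => // m _.
  rewrite addnS subn1 /=; elim: k => [|k IH]; first by rewrite add1n bin1.
  by rewrite (leq_trans IH) // addSn binS leq_addl.
have cy : convex_decreasing y.
  apply: convex_decreasingM; apply: convex_decreasing_affine => //.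
  - by rewrite divr_ge0.
  - exact: convex_decreasing_bin_sub.
  - by rewrite divr_ge0.
  - by rewrite subr_ge0 ler_pdivrMr ?ltr0n // mul1r ler_nat.
  - exact: convex_decreasing_inv_bin.
have yE s : (s <= Lam)%N -> corner_y R Lam lam K s = y s by apply: corner_yE.
clearbody y.
have Tle (nj : 'I_N * 'I_B) : (#|P nj.1 nj.2| <= Lam)%N.
  by rewrite -[leqRHS]card_ord max_card.
have := sum_max_load_lower_bound R lamLam (introT andP (conj K0 KN)) delL.
set m := \sum_(b in _) _; set Bs : R := (Bsize _ _ _)%:R => bound.
have -> : (#|Bens Lam K lam|%:R)^-1 *
    \sum_(b in Bens Lam K lam) wc_load R B (L b) = m / (Bs * B%:R).
  by rewrite card_Bens // -mulr_suml -/m invfM mulrCA.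
(* Double counting of the pairs of a cache and a bit stored in it. *)
have mean : (\sum_(nj : 'I_N * 'I_B) #|P nj.1 nj.2|)%N%:R <= Lam%:R * M * B%:R.
  have -> : (\sum_(nj : 'I_N * 'I_B) #|P nj.1 nj.2| =
      \sum_(l < Lam) \sum_(n < N) #|[set j : 'I_B | l \in P n j]|)%N.
    rewrite exchange_big -(pair_bigA _ (fun n j => #|P n j|)) /=.
    apply: eq_bigr => n _; under [RHS]eq_bigr => l _ do rewrite -sum1dep_card big_mkcond.
    rewrite exchange_big; apply: eq_bigr => j _ /=.
    by rewrite -sum1_card big_mkcond.
  rewrite natr_sum -mulrA; apply: le_trans (ler_sum _ (fun l _ => cacheP l)) _.
  by rewrite sumr_const card_ord mulr_natl.
rewrite !yE; try lia.
have [_ dy _] := cy t.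
set D := y t.+1 - y t; have D0 : D <= 0 by rewrite subr_le0.
have [Nn0 Ln0] : N%:R != 0 :> R /\ Lam%:R != 0 :> R by rewrite !pnatr_eq0 -!lt0n.
(* In units of [N / Lam] the corners sit at the integers, and [M] sits at [Lam * M / N]. *)
have -> : D * (M - corner_x R Lam N t) / (corner_x R Lam N t.+1 - corner_x R Lam N t)
    = D * (Lam%:R * M / N%:R - t%:R).
  by rewrite /corner_x -natr1; field; rewrite Nn0 Ln0.
have BsB0 : 0 < Bs * B%:R by rewrite mulr_gt0 ?ltr0n.
rewrite ler_pdivlMr // -(ler_pM2l (_ : 0 < N%:R)) ?ltr0n //.
apply: le_trans bound; rewrite -mulr_sumr.
apply: (@le_trans _ _ (Bs * \sum_(nj : 'I_N * 'I_B) (y t + D * (#|P nj.1 nj.2|%:R - t%:R)))); last first.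
  rewrite ler_wpM2l //; apply: ler_sum => nj _; rewrite yE //.
  exact: convex_decreasing_supporting_line.
rewrite big_split /= -mulr_sumr sumrB !sumr_const card_prod !card_ord -natr_sum.
rewrite -[y t *+ _]mulr_natl -[t%:R *+ _]mulr_natl natrM.
(* As the slope [D] is nonpositive, the upper bound on total storage becomes a lower bound on the
   load. *)
have := ler_wnM2l D0 mean; move: (\sum_nj _)%N => Z bnd.
have -> : N%:R * ((y t + D * (Lam%:R * M / N%:R - t%:R)) * (Bs * B%:R)) =
    Bs * (N%:R * B%:R * y t + (D * (Lam%:R * M * B%:R) - D * (N%:R * B%:R * t%:R))).
  by field.
by rewrite ler_wpM2l // mulrBr lerD2l lerD2r.
Qed.
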